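(* Let $w\in W_n$ be any partial Coxeter element that contains every toggle of the form $\tau_{i,i+1}$ ($1\le i\le n-1$). Then the triple $(\mathrm{NC}(n),\alpha,w)$ is $\frac{n-1}{2}$-mesic. This implies also that $(\mathrm{NC}(n),\beta,w)$ is $\frac{n+1}{2}$-mesic.
   Context: Let $[n]=\{1,\dots,n\}$. An arc is a pair $(i,j)$ with $1\le i<j\le n$. A partition of $[n]$ is noncrossing if whenever $1\le i<j<k<\ell\le n$ it does not happen that $i,k$ lie in one block and $j,\ell$ lie in a different block. A noncrossing partition $\pi$ is identified with its linear representation: the set $P$ of arcs $(i,j)$ such that $i,j$ are in the same block of $\pi$ and none of $i+1,\dots,j-1$ is in that block. Equivalently, $\mathrm{NC}(n)$ is the set of all sets $P$ of arcs containing no two distinct arcs $(i,j),(k,\ell)$ that (in some order) are crossing ($i<k<j<\ell$), left-nesting ($i=k<j<\ell$) or right-nesting ($i<k<j=\ell$). For an arc $(i,j)$, the toggle $\tau_{i,j}:\mathrm{NC}(n)\to\mathrm{NC}(n)$ is defined by $\tau_{i,j}(P)=P\setminus\{(i,j)\}$ if $(i,j)\in P$; $\tau_{i,j}(P)=P\cup\{(i,j)\}$ if $(i,j)\notin P$ and $P\cup\{(i,j)\}\in\mathrm{NC}(n)$; and $\tau_{i,j}(P)=P$ otherwise. The toggle group $W_n$ is the group of permutations of $\mathrm{NC}(n)$ generated by all toggles; products are compositions performed right to left. A partial Coxeter element is an element $w=\tau_{a_k}\tau_{a_{k-1}}\cdots\tau_{a_1}$ of $W_n$ where the $a_i$ are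 pairwise distinct arcs (not all arcs need occur); it contains the toggles $\tau_{a_1},\dots,\tau_{a_k}$. The arc count $\alpha(P)$ is the number of arcs in $P$; the block count $\beta(P)$ is the number of blocks of the noncrossing partition corresponding to $P$. For a finite set $X$, a function $f:X\to A$ to a $\mathbb{Q}$-vector space $A$, a bijection $T:X\to X$ and $c\in A$, the triple $(X,f,T)$ is $c$-mesic if for every $T$-orbit $\mathcal{O}$ one has $\frac{1}{\#\mathcal{O}}\sum_{x\in\mathcal{O}}f(x)=c$. *)

(* Defs.v *)
From HB Require Import structures.
From mathcomp Require Import all_boot all_order all_algebra all_fingroup.
From mathcomp Require Import zify.

Set Implicit Arguments.
Unset Strict Implicit.
Unset Printing Implicit Defensive.

Import GroupScope.

(* The ground set [n] = {1, ..., n} is represented by 'I_n = {0, ..., n-1}. *)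

Record arc_type (n : nat) : Type := Arc {
  endpoints : 'I_n * 'I_n;
  endpoints_lt : (endpoints.1 < endpoints.2)%N
}.
HB.instance Definition _ (n : nat) := [isSub for @endpoints n].
HB.instance Definition _ (n : nat) := [Finite of arc_type n by <:].

Definition src n (a : arc_type n) : 'I_n := (endpoints a).1.
Definition tgt n (a : arc_type n) : 'I_n := (endpoints a).2.

Definition crossing n (a b : arc_type n) : bool :=
  [&& src a < src b, src b < tgt a & tgt a < tgt b]%N.
Definition left_nesting n (a b : arc_type n) : bool :=
  (src a == src b) && (tgt a < tgt b)%N.
Definition right_nesting n (a b : arc_type n) : bool :=
  (src a < src b)%N && (tgt a == tgt b).

Definition is_nc n (P : {set arc_type n}) : bool :=
  [forall a in P, forall b in P, (a != b) ==>
     ~~ [|| crossing a b, left_nesting a b | right_nesting a b]].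

Record NC (n : nat) : Type := MkNC {
  arcs :> {set arc_type n};
  arcs_nc : is_nc arcs
}.
HB.instance Definition _ (n : nat) := [isSub for @arcs n].
HB.instance Definition _ (n : nat) := [Finite of NC n by <:].

Section Toggles.
Variable n : nat.
Implicit Types (a : arc_type n) (P : {set arc_type n}).

Definition toggle_set a P : {set arc_type n} :=
  if a \in P then P :\ a else if is_nc (a |: P) then a |: P else P.

Lemma is_ncS P (Q : {set arc_type n}) : P \subset Q -> is_nc Q -> is_nc P.
Proof.
move=> /subsetP sPQ /forall_inP ncQ; apply/forall_inP => a aP.
by apply/forall_inP => b bP; apply: (forall_inP (ncQ a _)); apply: sPQ.
Qed.

Lemma toggle_set_nc a (P : NC n) : is_nc (toggle_set a P).
Proof.
rewrite /toggle_set; case: ifP => _; last by case: ifP => // _; exact: valP.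
exact: is_ncS (subsetDl _ _) (valP P).
Qed.

Definition toggle_fun a (P : NC n) : NC n := MkNC (toggle_set_nc a P).

Lemma toggle_funK a : involutive (toggle_fun a).
Proof.
move=> P; apply: val_inj; rewrite /= /toggle_set.
have [aP | aNP] := boolP (a \in arcs P).
  by rewrite !inE eqxx /= setD1K // (valP P).
have [ncaP | /negPf ncaP] := boolP (is_nc (a |: arcs P)).
  by rewrite setU11 setU1K.
by rewrite (negPf aNP) ncaP.
Qed.

Definition toggle a : {perm NC n} := perm (inv_inj (toggle_funK a)).

Definition toggle_group : {group {perm NC n}} :=
  <<[set toggle a | a : arc_type n]>>%G.

(* [partial_coxeter w [:: a_1; ...; a_k]] says that w is the partial Coxeter
   element tau_(a_k) o ... o tau_(a_1), which contains the toggles at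
   a_1, ..., a_k. MathComp multiplies permutations from left to right,
   (u * v) P = v (u P), so that tau_(a_1) is the leftmost factor below. *)
Definition partial_coxeter (w : {perm NC n}) (s : seq (arc_type n)) : Prop :=
  uniq s /\ w = \prod_(a <- s) toggle a.

Lemma partial_coxeter_toggle_group w s :
  partial_coxeter w s -> w \in toggle_group.
Proof.
move=> [_ ->]; apply: group_prod => a _.
by apply: mem_gen; apply: imset_f.
Qed.

End Toggles.

Section Partitions.
Variable n : nat.
Implicit Types (P : {set arc_type n}) (pi : {set {set 'I_n}}) (i j k l : 'I_n).

Definition noncrossing pi : bool :=
  partition pi [set: 'I_n] &&
  [forall B in pi, forall C in pi, (B != C) ==>
     ~~ [exists i : 'I_n, exists j : 'I_n, exists k : 'I_n, exists l : 'I_n,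
          [&& i < j, j < k, k < l, i \in B, k \in B, j \in C & l \in C]%N]].

Definition linear_rep pi : {set arc_type n} :=
  [set a : arc_type n | [exists B in pi, [&& src a \in B, tgt a \in B &
     [forall k : 'I_n, (src a < k < tgt a)%N ==> (k \notin B)]]]].

Definition step P : rel 'I_n :=
  [rel i j | [exists a in P, (src a == i) && (tgt a == j)]].
Definition adj P : rel 'I_n := [rel i j | step P i j || step P j i].

(* The connected components of P; lemmas [noncrossing_partition_of],
   [partition_ofK] and [linear_repK] show that this is the inverse of the
   linear representation. *)
Definition partition_of P : {set {set 'I_n}} :=
  equivalence_partition (connect (adj P)) [set: 'I_n].

Lemma is_ncP P : reflect
  (forall a b, a \in P -> b \in P -> a != b ->
     ~~ [|| crossing a b, left_nesting a b | right_nesting a b]) (is_nc P).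
Proof.
apply: (iffP forall_inP) => [H a b aP bP ab | H a aP].
  exact: (implyP (forall_inP (H a aP) b bP)).
by apply/forall_inP => b bP; apply/implyP; apply: H.
Qed.

Lemma arc_ltn (a : arc_type n) : (src a < tgt a)%N.
Proof. exact: endpoints_lt. Qed.

Lemma arc_eq (a b : arc_type n) : src a = src b -> tgt a = tgt b -> a = b.
Proof.
move=> hs ht; apply: val_inj; rewrite /= [endpoints a]surjective_pairing.
by rewrite [endpoints b]surjective_pairing -/(src a) -/(tgt a) hs ht.
Qed.

Lemma stepP P i j :
  reflect (exists a, [/\ a \in P, src a = i & tgt a = j]) (step P i j).
Proof.
apply: (iffP existsP) => [[a /andP[aP /andP[/eqP <- /eqP <-]]] | [a [aP <- <-]]].
  by exists a.
by exists a; rewrite aP !eqxx.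
Qed.

Lemma adj_sym P : connect_sym (adj P).
Proof. by apply: sym_connect_sym => i j; rewrite /adj /= orbC. Qed.

Lemma adj_eqv P : {in [set: 'I_n] & &, equivalence_rel (connect (adj P))}.
Proof.
move=> x y z _ _ _; split=> [|xy]; first exact: connect0.
exact: (same_connect (@adj_sym P) xy z).
Qed.

Lemma partition_ofP P : partition (partition_of P) [set: 'I_n].
Proof. exact: equivalence_partitionP (@adj_eqv P). Qed.

Lemma partition_of_conn P B i j : B \in partition_of P ->
  i \in B -> (j \in B) = connect (adj P) i j.
Proof.
move=> /imsetP[x _ ->]; rewrite !inE /= => xi.
exact: (same_connect (@adj_sym P) xi j).
Qed.

Lemma partition_of_block P i :
  exists2 B, B \in partition_of P & i \in B.
Proof.
have /and3P[/eqP cov _ _] := partition_ofP P.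
have : i \in cover (partition_of P) by rewrite cov inE.
by move=> /bigcupP[B]; exists B.
Qed.

Section NCset.
Variable P : {set arc_type n}.
Hypothesis ncP : is_nc P.

Lemma step_funl i j k : step P i j -> step P i k -> j = k.
Proof.
move=> /stepP[a [aP ai aj]] /stepP[b [bP bi bk]].
have [ab | ab] := eqVneq a b; first by rewrite -aj -bk ab.
have := is_ncP _ ncP _ _ aP bP ab.
have := is_ncP _ ncP _ _ bP aP (introN eqP (fun e => elimN eqP ab (esym e))).
rewrite /crossing /left_nesting /right_nesting ai bi aj bk !eqxx /=.
by move=> *; apply: val_inj => /=; lia.
Qed.

Lemma step_funr i j k : step P i k -> step P j k -> i = j.
Proof.
move=> /stepP[a [aP ai ak]] /stepP[b [bP bj bk]].
have [ab | ab] := eqVneq a b; first by rewrite -ai -bj ab.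
have := is_ncP _ ncP _ _ aP bP ab.
have := is_ncP _ ncP _ _ bP aP (introN eqP (fun e => elimN eqP ab (esym e))).
rewrite /crossing /left_nesting /right_nesting ai bj ak bk !eqxx /= !andbT.
by move=> *; apply: val_inj => /=; lia.
Qed.

Lemma step_ltn i j : step P i j -> (i < j)%N.
Proof. by move=> /stepP[a [_ <- <-]]; exact: arc_ltn. Qed.

Lemma chainl i j : connect (step P) i j ->
  i = j \/ exists2 m, step P i m & connect (step P) m j.
Proof.
case/connectP=> [[|m p]] /= => [_ -> | /andP[im mp] ->]; first by left.
by right; exists m => //; apply/connectP; exists p.
Qed.

Lemma chainr i j : connect (step P) i j ->
  i = j \/ exists2 m, connect (step P) i m & step P m j.
Proof.
case/connectP=> p; case/lastP: p => [|p m] /=; first by left.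
rewrite rcons_path last_rcons => /andP[ip im] ->; right.
by exists (last i p) => //; apply/connectP; exists p.
Qed.

Lemma chain_leq i j : connect (step P) i j -> (i <= j)%N.
Proof.
case/connectP=> p; elim: p i => [|m p IHp] i /=; first by move=> _ ->.
by move=> /andP[/step_ltn im mp] /(IHp _ mp); apply: leq_trans; exact: ltnW.
Qed.

Lemma adj_chain i j : connect (adj P) i j ->
  connect (step P) i j \/ connect (step P) j i.
Proof.
case/connectP=> p; elim/last_ind: p j => [|p k IHp] j /=.
  by move=> _ ->; left.
rewrite rcons_path last_rcons => /andP[ip lk] ->{j}.
case: (IHp _ ip erefl) => [il | li]; case/orP: lk => lk.
- by left; apply: connect_trans il (connect1 lk).
- case: (chainr il) => [-> | [m im ml]]; first by right; apply: connect1.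
  by left; rewrite (step_funr lk ml).
- case: (chainl li) => [<- | [m lm mi]]; first by left; apply: connect1.
  by right; rewrite (step_funl lk lm).
- by right; apply: connect_trans (connect1 lk) li.
Qed.

Lemma adj_chain_leq i j : (i <= j)%N -> connect (adj P) i j ->
  connect (step P) i j.
Proof.
move=> ij /adj_chain[//|ji]; suff -> : i = j by [].
by apply: val_inj; apply/eqP; rewrite eqn_leq ij chain_leq.
Qed.

Lemma chain_adj i j : connect (step P) i j -> connect (adj P) i j.
Proof. by apply: connect_sub => x y xy; apply: connect1; rewrite /adj /= xy. Qed.

(* The arc of a chain passing over a given level. *)
Lemma chain_over i j (m : nat) : connect (step P) i j -> (i < m <= j)%N ->
  exists x y, [/\ connect (step P) i x, step P x y, connect (step P) y j
                & (x < m <= y)%N].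
Proof.
case/connectP=> p; elim: p i => [|y p IHp] i /=.
  by move=> _ -> /andP[im mi]; lia.
move=> /andP[iy yp] jE /andP[im mj].
have [my | ym] := leqP m y.
  exists i, y; split=> //; last by rewrite im my.
  by apply/connectP; exists p.
have [|x [z [yx xz zj xmz]]] := IHp y yp jE; first by rewrite ym mj.
exists x, z; split=> //; exact: connect_trans (connect1 iy) yx.
Qed.

Lemma noncrossing_partition_of : noncrossing (partition_of P).
Proof.
apply/andP; split; first exact: partition_ofP.
apply/forall_inP => B BP; apply/forall_inP => C CP; apply/implyP => BC.
apply/negP => /existsP[i /existsP[j /existsP[k /existsP[l]]]].
case/and5P=> ij jk kl iB /and3P[kB jC lC].
have disj x : x \in B -> x \in C -> False.
  have /and3P[_ /trivIsetP tI _] := partition_ofP P.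
  move=> xB xC; have := tI _ _ BP CP BC; rewrite disjoint_subset.
  by move=> /subsetP/(_ _ xB); rewrite inE xC.
have ik : connect (step P) i k.
  apply: adj_chain_leq; first exact: ltnW (ltn_trans ij jk).
  by rewrite -(partition_of_conn _ BP iB).
have jl : connect (step P) j l.
  apply: adj_chain_leq; first exact: ltnW (ltn_trans jk kl).
  by rewrite -(partition_of_conn _ CP jC).
have [|a [b [ia ab bk /andP[aj jb]]]] := chain_over ik (m := j).
  by rewrite ij ltnW.
have bB : b \in B.
  rewrite (partition_of_conn _ BP iB); apply: chain_adj.
  exact: connect_trans ia (connect1 ab).
have bk' := chain_leq bk.
have jNb : (j : nat) <> b by move=> /val_inj jb'; apply: (disj b); rewrite // -jb'.
have [|c [d [jc cd dl /andP[cb bd]]]] := chain_over jl (m := b).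
  rewrite ltn_neqAle jb andbT (leq_trans bk' (ltnW kl)) andbT; exact/eqP.
have dC : d \in C.
  rewrite (partition_of_conn _ CP jC); apply: chain_adj.
  exact: connect_trans jc (connect1 cd).
have bNd : (b : nat) <> d by move=> /val_inj bd'; apply: (disj b); rewrite // bd'.
have jc' := chain_leq jc.
case/stepP: ab => x [xP xa xb]; case/stepP: cd => y [yP yc yd].
have xy : x != y.
  apply/eqP => xy; move: xa yc; rewrite xy => -> ac.
  by move: (leq_trans aj jc'); rewrite ac ltnn.
case/norP: (is_ncP _ ncP _ _ xP yP xy) => /negP[].
rewrite /crossing xa xb yc yd (leq_trans aj jc') cb ltn_neqAle bd andbT; exact/eqP.
Qed.

Lemma partition_ofK : linear_rep (partition_of P) = P.
Proof.
apply/setP => a; rewrite inE; apply/idP/idP.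
  case/exists_inP=> B BP /and3P[sB tB /forallP gap].
  have st : connect (step P) (src a) (tgt a).
    by apply: adj_chain_leq; rewrite ?(ltnW (arc_ltn a)) // -(partition_of_conn _ BP sB).
  case: (chainl st) => [st' | [m sm mt]].
    by have := arc_ltn a; rewrite st' ltnn.
  have mB : m \in B.
    by rewrite (partition_of_conn _ BP sB); apply: chain_adj; exact: connect1.
  have := gap m; rewrite mB implybF (step_ltn sm) /= -leqNgt => tm.
  have mE : m = tgt a by apply: val_inj; apply/eqP; rewrite eqn_leq tm chain_leq.
  case/stepP: sm => b [bP bs bt]; suff -> : a = b by [].
  by apply: arc_eq; rewrite ?bs ?bt ?mE.
move=> aP.
have ast : step P (src a) (tgt a) by apply/stepP; exists a.
have [B BP sB] := partition_of_block P (src a).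
apply/exists_inP; exists B => //; rewrite sB /=.
rewrite (partition_of_conn _ BP sB) (chain_adj (connect1 ast)) /=.
apply/forallP => k; apply/implyP => /andP[sk kt].
rewrite (partition_of_conn _ BP sB); apply/negP => sk'.
have {sk'}/chainl[] := adj_chain_leq (ltnW sk) sk'.
  by move=> e; move: sk; rewrite e ltnn.
by move=> [m sm /chain_leq]; rewrite -(step_funl ast sm) leqNgt kt.
Qed.

End NCset.

Section NCpartition.
Variable pi : {set {set 'I_n}}.
Hypothesis ncpi : noncrossing pi.

Lemma nc_partition : partition pi [set: 'I_n].
Proof. by case/andP: ncpi. Qed.

Lemma block_inj B C i : B \in pi -> C \in pi -> i \in B -> i \in C -> B = C.
Proof.
have /and3P[_ tI _] := nc_partition => Bpi Cpi iB iC.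
by rewrite -(def_pblock tI Bpi iB) (def_pblock tI Cpi iC).
Qed.

Lemma noncrossing_lt B C i j k l : B \in pi -> C \in pi ->
  i \in B -> k \in B -> j \in C -> l \in C -> (i < j)%N -> (j < k)%N -> (k < l)%N ->
  B = C.
Proof.
move=> Bpi Cpi iB kB jC lC ij jk kl; case/andP: ncpi => _ /forall_inP/(_ B Bpi).
move=> /forall_inP/(_ C Cpi); have [//|_ /=] := eqVneq B C.
by case/existsP; exists i; apply/existsP; exists j; apply/existsP; exists k;
  apply/existsP; exists l; rewrite ij jk kl iB kB jC lC.
Qed.

Lemma linear_rep_nc : is_nc (linear_rep pi).
Proof.
apply/is_ncP => a b; rewrite !inE.
case/exists_inP=> B Bpi /and3P[aB aB' /forallP gapB].
case/exists_inP=> C Cpi /and3P[bC bC' /forallP gapC] ab.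
apply/negP; case/or3P.
- case/and3P=> h1 h2 h3.
  have BC : B = C by apply: (noncrossing_lt Bpi Cpi aB aB' bC bC').
  by have := gapB (src b); rewrite h1 h2 BC bC.
- case/andP=> /eqP e h; rewrite e in aB.
  have BC := block_inj Bpi Cpi aB bC.
  by have := gapC (tgt a); rewrite h -e arc_ltn -BC aB'.
- case/andP=> h /eqP e; rewrite e in aB'.
  have BC := block_inj Bpi Cpi aB' bC'.
  by have := gapB (src b); rewrite h e arc_ltn BC bC.
Qed.

Lemma linear_rep_step i j : step (linear_rep pi) i j ->
  forall B, B \in pi -> (i \in B) = (j \in B).
Proof.
move=> /stepP[a []]; rewrite inE => /exists_inP[C Cpi /and3P[sC tC _]] <- <- B Bpi.
apply/idP/idP => h; first by rewrite (block_inj Bpi Cpi h sC).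
by rewrite (block_inj Bpi Cpi h tC).
Qed.

Lemma linear_rep_conn i j B : B \in pi -> i \in B ->
  connect (adj (linear_rep pi)) i j = (j \in B).
Proof.
move=> Bpi iB; apply/idP/idP.
  case/connectP=> p; elim: p i iB => [|m p IHp] i iB /=; first by move=> _ ->.
  move=> /andP[im mp]; apply: IHp => //.
  by case/orP: im => /linear_rep_step/(_ B Bpi); rewrite iB.
wlog ij : i j iB / (i <= j)%N => [H|] jB.
  have [ij | /ltnW ji] := leqP i j; first exact: H.
  by rewrite adj_sym; apply: H.
have [d] := ubnP (j - i)%N; elim: d i j iB ij jB => // d IHd i j iB ij jB ltd.
have [-> | iNj] := eqVneq i j; first exact: connect0.
have {iNj} ij' : (i < j)%N by rewrite ltn_neqAle ij andbT; exact: iNj.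
have [/existsP[k /and3P[ik kj kB]] | /existsPn gap] :=
    boolP [exists k : 'I_n, [&& i < k, k < j & k \in B]%N].
  by apply: (@connect_trans _ _ k); apply: IHd => //; lia.
apply: connect1; rewrite /adj /=; apply/orP; left; apply/stepP.
exists (@Arc n (i, j) ij'); split=> //; rewrite inE.
apply/exists_inP; exists B => //; rewrite /src /tgt /= iB jB /=.
by apply/forallP => k; apply/implyP => /andP[ik kj]; have := gap k; rewrite ik kj.
Qed.

Lemma linear_repK : partition_of (linear_rep pi) = pi.
Proof.
have /and3P[/eqP cov _ pi0] := nc_partition.
have comp B i : B \in pi -> i \in B ->
    [set j in [set: 'I_n] | connect (adj (linear_rep pi)) i j] = B.
  by move=> Bpi iB; apply/setP => j; rewrite !inE /= (linear_rep_conn _ Bpi iB).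
apply/setP => B; apply/imsetP/idP => [[i _ ->] | Bpi].
  have : i \in cover pi by rewrite cov inE.
  by case/bigcupP=> C Cpi iC; rewrite (comp C).
have [B0 | [i iB]] := set_0Vmem B; first by rewrite -B0 Bpi in pi0.
by exists i => //; rewrite (comp B).
Qed.

End NCpartition.
End Partitions.

Definition arc_count n (P : NC n) : nat := #|arcs P|.
Definition block_count n (P : NC n) : nat := #|partition_of (arcs P)|.

Local Open Scope ring_scope.

Definition mesic (X : finType) (A : lmodType rat) (f : X -> A) (T : {perm X})
    (c : A) : Prop :=
  forall O : {set X}, O \in porbits T ->
    #|O|%:R^-1 *: (\sum_(x in O) f x) = c.

(* Main.v *)
(** For [t = (i, i+1)] let [c_t a] be [a = (i, _)] plus [a = (_, i+1)], a number
    that is 2 at [a = t].  The arcs incompatible with [t] are exactly the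
    [a <> t] with [c_t a > 0]; they have [c_t a = 1] and are pairwise
    incompatible, as [(i, j)] crosses [(k, i+1)].  So, applying the toggle at [t]
    to [Q], membership of [t] before plus membership of [t] after plus
    [\sum_(a in Q, a != t) c_t a] is always 1.  Along an orbit of [w] each
    membership indicator changes at most once per application of [w], hence has
    the same total whether it is sampled before or after any prefix of [w].
    Summing over the orbit shows that [\sum_(a in P) c_t a] has average 1, and
    the sum of these statistics over [t] is twice the arc count.

    For blocks, the indices that are not the source of an arc form a transversal
    of the blocks, so arcs and blocks together number [n]. *)
Require Import Defs.
From mathcomp Require Import all_boot all_order all_algebra all_fingroup.
From mathcomp Require Import zify lra.

Set Implicit Arguments.
Unset Strict Implicit.
Unset Printing Implicit Defensive.

Import GRing.Theory Num.Theory.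

(** * Sums over orbits *)

Lemma porbits_perm_in (T : finType) (w : {perm T}) (O : {set T}) (x : T) :
  O \in porbits w -> (w x \in O) = (x \in O).
Proof.
case/imsetP=> y _ ->; rewrite -!eq_porbit_mem.
by have := porbit_perm w 1 x; rewrite expg1 => ->.
Qed.

Lemma sum_porbit_perm (T : finType) (w : {perm T}) (O : {set T}) (F : T -> nat) :
  O \in porbits w -> \sum_(x in O) F (w x) = \sum_(x in O) F x.
Proof.
move=> wO; rewrite [RHS](reindex_inj (@perm_inj _ w)) /=.
by apply: eq_bigl => x; rewrite porbits_perm_in.
Qed.

(** * Toggles at the arcs [(i, i+1)] along an orbit *)

Section Toggling.
Variable n : nat.
Implicit Types (a b t : arc_type n) (P : NC n) (s u v : seq (arc_type n)).

Definition simple t : bool := tgt t == (src t).+1 :> nat.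

(** The number [c_t a]. *)
Definition incidence t a : nat := (src a == src t) + (tgt a == tgt t).

Lemma in_toggle_neq a b P : a != b -> (a \in arcs (toggle b P)) = (a \in arcs P).
Proof.
move=> ab; rewrite permE /= /toggle_set.
by case: ifP => _; [|case: ifP => _]; rewrite ?inE ?(negPf ab).
Qed.

Lemma in_toggles_notin a s P : a \notin s ->
  (a \in arcs ((\prod_(b <- s) toggle b)%g P)) = (a \in arcs P).
Proof.
elim: s P => [|b s IHs] P; first by rewrite big_nil perm1.
rewrite inE negb_or big_cons permM => /andP[ab /IHs ->].
exact: in_toggle_neq.
Qed.

(** If [a] is in [u], it is not in [v], so its indicator after [u] equals that after all of [w], and
    [w] permutes [O]. If [a] is not in [u], the prefix leaves its indicator alone. *)
Lemma sum_porbit_prefix u v (w : {perm NC n}) (O : {set NC n}) a :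
  uniq (u ++ v) -> w = (\prod_(b <- u ++ v) toggle b)%g -> O \in porbits w ->
  \sum_(P in O) (a \in arcs ((\prod_(b <- u) toggle b)%g P) : nat) =
  \sum_(P in O) (a \in arcs P : nat).
Proof.
rewrite cat_uniq big_cat => /and3P[_ /hasPn uv _] wE wO.
have [au | aNu] := boolP (a \in u); last first.
  by apply: eq_bigr => P _; rewrite in_toggles_notin.
have aNv : a \notin v by apply/negP => /uv; rewrite /= au.
rewrite -[RHS](sum_porbit_perm _ wO); apply: eq_bigr => P _.
by rewrite wE permM [in RHS]in_toggles_notin.
Qed.

(** A shared source or target gives a nesting; otherwise one arc is [(i, j)] with [j > i+1], the
    other [(k, i+1)] with [k < i], and they cross. *)
Lemma incidence_gt0 t a b : simple t -> incidence t a > 0 -> incidence t b > 0 ->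
  a != b -> [|| crossing a b, left_nesting a b | right_nesting a b] ||
            [|| crossing b a, left_nesting b a | right_nesting b a].
Proof.
move=> /eqP tS aI bI /eqP ab.
have abN : ~ ((src a = src b :> nat) /\ (tgt a = tgt b :> nat)).
  by move=> [/val_inj es /val_inj et]; apply: ab; apply: arc_eq.
have := arc_ltn a; have := arc_ltn b; move: aI bI.
rewrite /incidence /crossing /left_nesting /right_nesting -!val_eqE /=; lia.
Qed.

Lemma incidence_neq t a : a != t -> incidence t a <= 1.
Proof.
rewrite /incidence; have [es|_] := eqVneq (src a) (src t); last by rewrite add0n leq_b1.
have [et|//] := eqVneq (tgt a) (tgt t).
by rewrite (arc_eq es et) eqxx.
Qed.

(** Nesting needs a shared endpoint, and crossing [t] needs an endpoint strictly between [i] and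
    [i+1]. *)
Lemma incidence0 t a : simple t -> incidence t a = 0 ->
  ~~ [|| crossing t a, left_nesting t a | right_nesting t a] /\
  ~~ [|| crossing a t, left_nesting a t | right_nesting a t].
Proof.
rewrite /incidence /simple /crossing /left_nesting /right_nesting -!val_eqE /=.
move=> /eqP tS aI; have := arc_ltn a; move: aI; lia.
Qed.

Lemma nc_incidence_uniq t (P : {set arc_type n}) a b : simple t -> is_nc P ->
  a \in P -> b \in P -> incidence t a > 0 -> incidence t b > 0 -> a = b.
Proof.
move=> tS /is_ncP ncP aP bP aI bI; apply/eqP; apply: contraT => ab.
have := incidence_gt0 tS aI bI ab.
by rewrite (negPf (ncP _ _ aP bP ab)) (negPf (ncP _ _ bP aP _)) // eq_sym.
Qed.

Lemma nc_setU1 t P : simple t ->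
  (forall a, a \in arcs P -> incidence t a = 0) -> is_nc (t |: arcs P).
Proof.
move=> tS PI; apply/is_ncP => a b; rewrite !inE.
case/predU1P=> [->|aP] /predU1P[->|bP]; rewrite ?eqxx // => ab.
- by case: (incidence0 tS (PI b bP)).
- by case: (incidence0 tS (PI a aP)).
- exact: (is_ncP _ (arcs_nc P)).
Qed.

(** At most one arc [b] of [P] has positive incidence. The three summands are 1, 0, 0 if [b = t]
    (the toggle removes [t]), 0, 0, 1 if [b != t] (it is blocked), and 0, 1, 0 if there is no [b]
    (it adds [t]). *)
Lemma toggle_simple t P : simple t ->
  (t \in arcs P) + (t \in arcs (toggle t P)) +
  \sum_(a | a != t) incidence t a * (a \in arcs P) = 1.
Proof.
move=> tS; have tt : incidence t t = 2 by rewrite /incidence !eqxx.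
have [[b bP bI] | PI] : (exists2 b, b \in arcs P & incidence t b > 0) \/
    (forall a, a \in arcs P -> incidence t a = 0).
- have [/existsP[b /andP[bP bI]] | /existsPn PI] :=
    boolP [exists b, (b \in arcs P) && (incidence t b > 0)].
    by left; exists b.
  by right=> a aP; have := PI a; rewrite aP /= lt0n negbK => /eqP.
- have uniqb a : a \in arcs P -> incidence t a > 0 -> a = b.
    by move=> aP aI; apply: (nc_incidence_uniq tS (arcs_nc P)).
  have [bt | bt] := eqVneq b t.
    rewrite bt in bP uniqb.
    rewrite bP permE /= /toggle_set bP !inE eqxx /= big1 // => a at'.
    have [aP | _] := boolP (a \in arcs P); last by rewrite muln0.
    have [-> // | aI] := posnP (incidence t a).
    by move: at'; rewrite (uniqb a aP aI) eqxx.
  have tP : t \notin arcs P.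
    by apply/negP => tP; rewrite -(uniqb t tP) ?tt ?eqxx in bt.
  have tnc : is_nc (t |: arcs P) = false.
    apply/negP => nc; move/eqP: bt; apply.
    by apply: (nc_incidence_uniq tS nc); rewrite ?inE ?bP ?eqxx ?orbT ?tt.
  rewrite permE /= /toggle_set (negPf tP) tnc (negPf tP) (bigD1 b) //= bP.
  rewrite big1 ?addn0 => [|a /andP[_ ab]].
    by have := incidence_neq bt; lia.
  have [aP | _] := boolP (a \in arcs P); last by rewrite muln0.
  have [-> // | aI] := posnP (incidence t a).
  by move: ab; rewrite (uniqb a aP aI) eqxx.
have tP : t \notin arcs P by apply/negP => /PI; rewrite tt.
rewrite permE /= /toggle_set (negPf tP) nc_setU1 // !inE eqxx /=.
rewrite big1 // => a _; have [/PI -> // | _] := boolP (a \in arcs P).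
by rewrite muln0.
Qed.

Lemma sum_porbit_incidence s (w : {perm NC n}) (O : {set NC n}) t :
  partial_coxeter w s -> simple t -> t \in s -> O \in porbits w ->
  \sum_(P in O) \sum_(a in arcs P) incidence t a = #|O|.
Proof.
move=> [us wE] tS ts wO; case/splitPr: ts us wE => u v us wE.
pose A := (\prod_(b <- u) toggle b)%g.
have preA a : \sum_(P in O) (a \in arcs (A P) : nat) =
    \sum_(P in O) (a \in arcs P : nat).
  exact: (sum_porbit_prefix a us wE wO).
have preAt a : \sum_(P in O) (a \in arcs (toggle t (A P)) : nat) =
    \sum_(P in O) (a \in arcs P : nat).
  (* Now [rcons u t] is the prefix. *)
  rewrite -cat_rcons in us wE; rewrite -(sum_porbit_prefix a us wE wO).
  by apply: eq_bigr => P _; rewrite -cats1 big_cat big_seq1 permM.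
(* Each 1 counted by [#|O|] is expanded at the moment just before [t] is toggled. *)
rewrite -sum1_card; under [RHS]eq_bigr => P _ do rewrite -(toggle_simple (A P) tS).
rewrite !big_split /= preA preAt exchange_big /=.
have -> : \sum_(a | a != t) \sum_(P in O) incidence t a * (a \in arcs (A P)) =
    \sum_(a | a != t) \sum_(P in O) incidence t a * (a \in arcs P).
  by apply: eq_bigr => a _; rewrite -[LHS]big_distrr -[RHS]big_distrr /= preA.
rewrite [X in _ + X]exchange_big -!big_split /=; apply: eq_bigr => P _.
have -> : \sum_(a in arcs P) incidence t a =
    \sum_a incidence t a * (a \in arcs P).
  by rewrite big_mkcond; apply: eq_bigr => a _; case: ifP; rewrite ?muln1 ?muln0.
(* The indicators of [t] before and after its toggle together make up the term [a = t], of weight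
   2. *)
by rewrite (bigD1 t) //= /incidence !eqxx; lia.
Qed.

End Toggling.

(** * From incidences to the arc count *)

Section Counting.
Variable n : nat.

Lemma simple_arc_subproof (i : 'I_n) :
  ((widen_ord (leqnSn n) i, lift ord0 i).1 <
   (widen_ord (leqnSn n) i, lift ord0 i).2)%N.
Proof. by rewrite /= /bump. Qed.

Definition simple_arc (i : 'I_n) : arc_type n.+1 := Arc (simple_arc_subproof i).

Lemma simple_arcP i : simple (simple_arc i).
Proof. exact: eqxx. Qed.

(** The source of [a] counts at [i = src a] only, its target at [i = tgt a - 1] only. *)
Lemma sum_incidence (a : arc_type n.+1) :
  \sum_(i < n) incidence (simple_arc i) a = 2.
Proof.
have sn : src a < n by have := arc_ltn a; have := ltn_ord (tgt a); lia.
have tn : (tgt a).-1 < n by have := arc_ltn a; have := ltn_ord (tgt a); lia.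
rewrite big_split /= (bigD1 (Ordinal sn)) //= [X in _ + X](bigD1 (Ordinal tn)) //=.
have -> : src a == src (simple_arc (Ordinal sn)) by apply/eqP/val_inj.
have -> : tgt a == tgt (simple_arc (Ordinal tn)).
  by apply/eqP/val_inj; have := arc_ltn a; rewrite /= /bump /=; lia.
rewrite !big1 // => i; rewrite -val_eqE /= => iE; apply/eqP; rewrite eqb0 -val_eqE /=.
  by have := arc_ltn a; move: iE; rewrite /bump /=; lia.
by rewrite eq_sym.
Qed.

Lemma sum_porbit_arc_count s (w : {perm NC n.+1}) (O : {set NC n.+1}) :
  partial_coxeter w s -> (forall t, simple t -> t \in s) -> O \in porbits w ->
  2 * \sum_(P in O) arc_count P = n * #|O|.
Proof.
move=> ws sS wO; rewrite big_distrr /=.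
transitivity (\sum_(P in O) \sum_(i < n) \sum_(a in arcs P)
    incidence (simple_arc i) a).
  apply: eq_bigr => P _; rewrite exchange_big /=.
  under eq_bigr => a _ do rewrite sum_incidence.
  by rewrite sum_nat_const mulnC.
rewrite exchange_big /=; under eq_bigr => i _.
  rewrite (sum_porbit_incidence ws (simple_arcP i)) ?sS ?simple_arcP //; over.
by rewrite sum_nat_const card_ord.
Qed.

End Counting.

(** * Blocks against arcs *)

Lemma block_arc_count n (P : NC n) : (block_count P + arc_count P = n)%N.
Proof.
have ncP := arcs_nc P.
pose S := [set src a | a in arcs P].
have cardS : #|S| = arc_count P.
  apply: card_in_imset => a b aP bP ab; apply: arc_eq => //.
  by apply: (step_funl ncP (i := src a)); apply/stepP; [exists a | exists b].
have stepS i j : step (arcs P) i j -> i \in S.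
  by case/stepP=> a [aP <- _]; apply: imset_f.
pose blk i := [set j in [set: 'I_n] | connect (adj (arcs P)) i j].
have blk_eq i j : connect (adj (arcs P)) i j -> blk i = blk j.
  by move=> ij; apply/setP => k; rewrite !inE (same_connect (@adj_sym _ _) ij).
(* Following arcs to the right ends at a non-source in the same block. *)
have reach i : exists2 j, j \notin S & blk i = blk j.
  have [d] := ubnP (n - i)%N; elim: d i => // d IHd i id.
  have [/imsetP[a aP ia] | iS] := boolP (i \in S); last by exists i.
  have st : step (arcs P) i (tgt a) by apply/stepP; exists a.
  have [|j jS ej] := IHd (tgt a).
    by have := step_ltn st; have := ltn_ord (tgt a); lia.
  exists j => //; rewrite -ej; apply: blk_eq; apply: chain_adj.
  exact: connect1.
have -> : block_count P = #|~: S|.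
  rewrite /block_count.
  have -> : partition_of (arcs P) = blk @: (~: S).
    apply/setP => B; apply/imsetP/imsetP => [[i _ ->] | [i _ ->]]; last by exists i.
    by have [j jS ij] := reach i; exists j; rewrite // inE.
  apply: card_in_imset => i j; rewrite !inE => iS jS ij.
  have : j \in blk i by rewrite ij !inE connect0.
  (* A chain joins two non-sources of one block; it cannot leave its starting point, so they are
     equal. *)
  rewrite !inE /= => /(adj_chain ncP)[] /chainl [] // [k /stepS].
    by rewrite (negPf iS).
  by rewrite (negPf jS).
by rewrite -cardS addnC cardsC card_ord.
Qed.

Local Open Scope ring_scope.

Theorem theorem4p5 (n : nat) (n_gt0 : (0 < n)%N)
    (w : {perm NC n}) (s : seq (arc_type n)) (w_coxeter : partial_coxeter w s)
    (s_simple : forall a : arc_type n, (tgt a = (src a).+1 :> nat) -> a \in s) :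
  mesic (fun P : NC n => (arc_count P)%:R : rat^o) w ((n%:R - 1) / 2%:R : rat) /\
  mesic (fun P : NC n => (block_count P)%:R : rat^o) w ((n%:R + 1) / 2%:R : rat).
Proof.
case: n n_gt0 w s w_coxeter s_simple => // n _ w s ws sS.
have arcE O : O \in porbits w ->
    2 * (\sum_(P in O) (arc_count P)%:R) = n%:R * #|O|%:R :> rat.
  move=> wO; rewrite -natr_sum -!natrM (sum_porbit_arc_count ws) // => t /eqP.
  exact: sS.
have card_neq0 O : O \in porbits w -> #|O|%:R != 0 :> rat.
  by case/imsetP=> P _ ->; rewrite pnatr_eq0 -lt0n card_gt0; apply/set0Pn;
    exists P; exact: porbit_id.
split=> O wO; have := arcE O wO; have O0 := card_neq0 O wO.
  (* Scaling on [rat^o] is multiplication, so the nonzero orbit size can be cleared. *)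
  rewrite -[_ *: _]/(_ * _) => E; apply: (mulfI O0); rewrite mulVKf //.
  by rewrite -natr1; lra.
have blockE : \sum_(P in O) (block_count P)%:R =
    n.+1%:R * #|O|%:R - \sum_(P in O) (arc_count P)%:R :> rat.
  apply/eqP; rewrite -subr_eq opprK -big_split /= mulr_natr -sumr_const.
  by apply/eqP; apply: eq_bigr => P _; rewrite -natrD block_arc_count.
move=> E; rewrite -[_ *: _]/(_ * _); apply: (mulfI O0); rewrite mulVKf //.
by rewrite [LHS]blockE -natr1; lra.
Qed.
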